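(* Let $F,G\in C^\infty(\mathbb{R})$ and $u(x_1,x_2)=F(x_1+x_2)+G(x_1-x_2)$ on $\mathbb{R}^2$. If $$4F''(x_1+x_2)\,G''(x_1-x_2)+1\neq0\quad\text{for all }(x_1,x_2)\in\mathbb{R}^2,$$ then the surface $M=\{(x_1,x_2,-u_{x_1},u_{x_2}):(x_1,x_2)\in\mathbb{R}^2\}$, with a suitable choice of orientation, is a timelike special Lagrangian surface in $C_1^2$. Conversely, every timelike special Lagrangian surface in $C_1^2$ that is the graph of a smooth map $\mathbb{R}^2\to\mathbb{R}^2$ (over $\mathbb{R}^2=\{y=0\}$) is obtained in this way.
   Context: $C_1^2$ denotes $\mathbb{C}^2=\mathbb{R}^4$ with coordinates $(x_1,x_2,y_1,y_2)$, $z_j=x_j+iy_j$, metric $g=-(dx_1^2+dy_1^2)+(dx_2^2+dy_2^2)$ and symplectic form $\omega_{(1,2)}=-dx_1\wedge dy_1+dx_2\wedge dy_2$. A surface $M\subset C_1^2$ is Lagrangian if $\omega_{(1,2)}|_M\equiv0$ and the metric induced by $g$ is non-degenerate. An oriented Lagrangian surface is timelike special Lagrangian if $dz_1\wedge dz_2(e_1,e_2)=1$ for every positively oriented basis $e_1,e_2$ of every $T_pM$ with $g(e_1,e_1)=-1$, $g(e_2,e_2)=1$, $g(e_1,e_2)=0$. *)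

(* Defs.v *)
From Stdlib Require Import Reals.
From Coquelicot Require Import Coquelicot.

Open Scope R_scope.

Definition smooth (F : R -> R) : Prop := forall (n : nat) (x : R), ex_derive_n F n x.

(* Over an open set [V] this is C^oo on [V]: [ex_diff_n f n] asks for all
   iterated partial derivatives up to order [n], with continuity. *)
Definition smooth2_on (V : R * R -> Prop) (f : R -> R -> R) : Prop :=
  forall u v : R, V (u, v) -> forall n : nat, ex_diff_n f n u v.

Definition smooth2 (f : R -> R -> R) : Prop := smooth2_on (fun _ => True) f.

(* C^2 = R^4: the point with coordinates (x1, x2, y1, y2) is the pair
   (z1, z2) = ((x1, y1), (x2, y2)), since Coquelicot's [C] is [R * R].
   The same type serves for points and for tangent vectors. *)
Definition C12 : Type := (C * C)%type.

Definition x1 (z : C12) : R := Re (fst z).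
Definition x2 (z : C12) : R := Re (snd z).
Definition y1 (z : C12) : R := Im (fst z).
Definition y2 (z : C12) : R := Im (snd z).

Definition g (v w : C12) : R :=
  - (x1 v * x1 w + y1 v * y1 w) + (x2 v * x2 w + y2 v * y2 w).

Definition omega12 (v w : C12) : R :=
  - (x1 v * y1 w - y1 v * x1 w) + (x2 v * y2 w - y2 v * x2 w).

Definition dz1_dz2 (v w : C12) : C := (fst v * snd w - snd v * fst w)%C.

Definition lincomb (a : R) (v : C12) (b : R) (w : C12) : C12 :=
  ((a * fst v + b * fst w)%C, (a * snd v + b * snd w)%C).

Definition zero12 : C12 := (RtoC 0, RtoC 0).

Definition lin_indep (v w : C12) : Prop :=
  forall a b : R, lincomb a v b w = zero12 -> a = 0 /\ b = 0.

Definition same_orientation (v1 v2 e1 e2 : C12) : Prop :=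
  exists a b c d : R,
    e1 = lincomb a v1 b v2 /\ e2 = lincomb c v1 d v2 /\ 0 < a * d - b * c.

Definition velocity (gam : R -> C12) (t : R) : C12 :=
  ((Derive (fun s => x1 (gam s)) t, Derive (fun s => y1 (gam s)) t),
   (Derive (fun s => x2 (gam s)) t, Derive (fun s => y2 (gam s)) t)).

Definition d_u (phi : R -> R -> C12) (u v : R) : C12 := velocity (fun s => phi s v) u.
Definition d_v (phi : R -> R -> C12) (u v : R) : C12 := velocity (fun s => phi u s) v.

(* [chart_openmap], with [chart_inj] and continuity, says that [phi] is a
   homeomorphism from [V] onto a relatively open subset of [M], so the surfaces
   below are embedded. *)
Record chart (M : C12 -> Prop) (V : R * R -> Prop) (phi : R -> R -> C12) : Prop := {
  chart_open : open V;
  chart_smooth_x1 : smooth2_on V (fun u v => x1 (phi u v));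
  chart_smooth_x2 : smooth2_on V (fun u v => x2 (phi u v));
  chart_smooth_y1 : smooth2_on V (fun u v => y1 (phi u v));
  chart_smooth_y2 : smooth2_on V (fun u v => y2 (phi u v));
  chart_immersion : forall u v, V (u, v) -> lin_indep (d_u phi u v) (d_v phi u v);
  chart_inj : forall u v u' v', V (u, v) -> V (u', v') ->
    phi u v = phi u' v' -> u = u' /\ v = v';
  chart_openmap : forall W : R * R -> Prop,
    open W -> (forall q, W q -> V q) ->
    exists U : C * C -> Prop, open U /\
      forall z : C12, (M z /\ U z) <-> (exists u v, W (u, v) /\ phi u v = z)
}.

Definition surface (M : C12 -> Prop) : Prop :=
  forall p, M p -> exists (V : R * R -> Prop) (phi : R -> R -> C12),
    chart M V phi /\ exists u v, V (u, v) /\ phi u v = p.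

(* Velocities at [p] of smooth curves in [M]. *)
Definition tangent (M : C12 -> Prop) (p v : C12) : Prop :=
  exists gam : R -> C12,
    gam 0 = p /\ velocity gam 0 = v /\
    locally (T := R_UniformSpace) 0 (fun t =>
      M (gam t) /\
      forall n : nat,
        ex_derive_n (fun s => x1 (gam s)) n t /\
        ex_derive_n (fun s => x2 (gam s)) n t /\
        ex_derive_n (fun s => y1 (gam s)) n t /\
        ex_derive_n (fun s => y2 (gam s)) n t).

Definition lagrangian (M : C12 -> Prop) : Prop :=
  surface M /\
  (forall p v w, M p -> tangent M p v -> tangent M p w -> omega12 v w = 0) /\
  (forall p v, M p -> tangent M p v ->
     (forall w, tangent M p w -> g v w = 0) -> v = zero12).

(* [O p e1 e2] reads: (e1, e2) is a positively oriented basis of T_p M.  Requiring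
   around each point a chart whose coordinate bases are all positive makes each
   [O p] one of the two classes of bases of T_p M and makes the choice continuous
   in p.  The values of [O] at points outside [M] are irrelevant. *)
Definition orientation (M : C12 -> Prop) (O : C12 -> C12 -> C12 -> Prop) : Prop :=
  forall p, M p -> exists (V : R * R -> Prop) (phi : R -> R -> C12),
    chart M V phi /\
    (exists u v, V (u, v) /\ phi u v = p) /\
    (forall u v, V (u, v) -> forall e1 e2,
       O (phi u v) e1 e2 <-> same_orientation (d_u phi u v) (d_v phi u v) e1 e2).

Definition timelike_special_lagrangian
    (M : C12 -> Prop) (O : C12 -> C12 -> C12 -> Prop) : Prop :=
  lagrangian M /\ orientation M O /\
  forall p e1 e2, M p -> O p e1 e2 ->
    g e1 e1 = -1 -> g e2 e2 = 1 -> g e1 e2 = 0 -> dz1_dz2 e1 e2 = RtoC 1.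

Definition graph (f1 f2 : R -> R -> R) (z : C12) : Prop :=
  exists a b : R, z = ((a, f1 a b), (b, f2 a b)).

Definition gradient_graph (u : R -> R -> R) : C12 -> Prop :=
  graph (fun a b => - Derive (fun s => u s b) a) (fun a b => Derive (fun s => u a s) b).

(* Main.v *)
(* With [dz] the complex determinant of a tangent basis [v], [w], the Hermitian form
   [g + i omega12] has Gram determinant [- |dz|^2].  So where [omega12] vanishes, the
   induced metric is non-degenerate iff [dz <> 0]; it then has signature (1, 1) and
   [dz] has modulus 1 on every adapted orthonormal basis.  For a graph
   [(x, f1, f2)] the conditions [omega12 = 0] and [Im dz = 0] read
   [d2 f1 = - d1 f2] and [d2 f2 = - d1 f1]: the functions [f2 - f1] and [f1 + f2]
   solve the two transport equations of the wave operator and hence depend only on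
   [x1 + x2] and [x1 - x2].  For such a graph [dz = 4 F'' G'' + 1] is real, and,
   having constant sign, is positive for a suitable global orientation. *)
Require Import Defs.
From Stdlib Require Import Reals Lra FunctionalExtensionality PropExtensionality.
From Coquelicot Require Import Coquelicot.
Open Scope R_scope.

(** * Calculus of smooth functions of one and two real variables *)

Definition D1 (f : R -> R -> R) (a b : R) : R := Derive (fun s => f s b) a.
Definition D2 (f : R -> R -> R) (a b : R) : R := Derive (fun s => f a s) b.

Lemma locally_open_2d (V : R * R -> Prop) (P : R -> R -> Prop) (u v : R) :
  open V -> V (u, v) -> (forall u' v', V (u', v') -> P u' v') -> locally_2d P u v.
Proof.
  intros hV huv hP. apply locally_2d_locally.
  apply (locally_open V _ hV); [| exact huv].
  intros [u' v'] h. exact (hP _ _ h).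
Qed.

(** Induction on [n]. The hypotheses range over the whole open set [V] because the formula for the
    partial derivatives of the combination must hold near the point, not only at it, to be
    differentiated again. *)
Lemma ex_diff_n_lincomb (V : R * R -> Prop) (a b : R) (n : nat) (f h : R -> R -> R) :
  open V ->
  (forall u v, V (u, v) -> ex_diff_n f n u v) ->
  (forall u v, V (u, v) -> ex_diff_n h n u v) ->
  forall u v, V (u, v) -> ex_diff_n (fun s t => a * f s t + b * h s t) n u v.
Proof.
  intros hV. revert f h. induction n as [|n IH]; intros f h hf hh u v huv.
  - split; [| exact I].
    apply continuity_2d_pt_plus; (apply continuity_2d_pt_mult;
      [apply continuity_2d_pt_const |]); [apply (hf u v huv) | apply (hh u v huv)].
  - destruct (hf u v huv) as (fc & f1 & f2 & _), (hh u v huv) as (hc & h1 & h2 & _).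
    repeat split.
    + apply continuity_2d_pt_plus; (apply continuity_2d_pt_mult;
        [apply continuity_2d_pt_const |]); assumption.
    + auto_derive; auto.
    + auto_derive; auto.
    + apply ex_diff_n_ext_loc with (fun s t => a * D1 f s t + b * D1 h s t).
      * apply (locally_open_2d V); auto. intros u' v' h'.
        destruct (hf u' v' h') as (_ & f1' & _), (hh u' v' h') as (_ & h1' & _).
        symmetry. unfold D1. rewrite Derive_plus by (auto_derive; auto).
        now rewrite !Derive_scal.
      * apply IH; auto; intros s t hst;
        [apply (hf s t hst) | apply (hh s t hst)].
    + apply ex_diff_n_ext_loc with (fun s t => a * D2 f s t + b * D2 h s t).
      * apply (locally_open_2d V); auto. intros u' v' h'.
        destruct (hf u' v' h') as (_ & _ & f1' & _), (hh u' v' h') as (_ & _ & h1' & _).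
        symmetry. unfold D2. rewrite Derive_plus by (auto_derive; auto).
        now rewrite !Derive_scal.
      * apply IH; auto; intros s t hst;
        [apply (hf s t hst) | apply (hh s t hst)].
Qed.

Lemma smooth2_on_lincomb (V : R * R -> Prop) (a b : R) (f h : R -> R -> R) :
  open V -> smooth2_on V f -> smooth2_on V h ->
  smooth2_on V (fun s t => a * f s t + b * h s t).
Proof.
  intros hV hf hh u v huv n. now apply (ex_diff_n_lincomb V); auto.
Qed.

Lemma smooth2_on_D1 (V : R * R -> Prop) (f : R -> R -> R) :
  smooth2_on V f -> smooth2_on V (D1 f).
Proof. intros hf u v huv n. exact (proj1 (proj2 (proj2 (proj2 (hf u v huv (S n)))))). Qed.

Lemma smooth2_on_D2 (V : R * R -> Prop) (f : R -> R -> R) :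
  smooth2_on V f -> smooth2_on V (D2 f).
Proof. intros hf u v huv n. exact (proj2 (proj2 (proj2 (proj2 (hf u v huv (S n)))))). Qed.

Lemma smooth2_ext (f h : R -> R -> R) :
  (forall u v, f u v = h u v) -> smooth2 f -> smooth2 h.
Proof.
  intros e hf u v _ n. apply ex_diff_n_ext_loc with f; [| now apply hf].
  apply locally_2d_forall. intros; apply e.
Qed.

Lemma ex_diff_n_swap (n : nat) (f : R -> R -> R) (u v : R) :
  ex_diff_n f n v u -> ex_diff_n (fun s t => f t s) n u v.
Proof.
  assert (C : forall f u v, continuity_2d_pt f v u ->
    continuity_2d_pt (fun s t => f t s) u v).
  { clear. intros f u v h eps. destruct (h eps) as [d hd].
    exists d. intros; now apply hd. }
  revert f u v. induction n as [|n IH]; intros f u v h.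
  - split; [apply C, h | exact I].
  - destruct h as (c & e1 & e2 & h1 & h2). repeat split; auto.
Qed.

Lemma smooth2_swap (f : R -> R -> R) : smooth2 f -> smooth2 (fun s t => f t s).
Proof. intros hf u v _ n. now apply ex_diff_n_swap, hf. Qed.

Lemma smooth_ex_derive (F : R -> R) (x : R) : smooth F -> ex_derive F x.
Proof. intros hF. exact (hF 1%nat x). Qed.

Lemma smooth_Derive (F : R -> R) : smooth F -> smooth (Derive F).
Proof.
  (* Order 0 is vacuous; order [S n] for [Derive F] is order [S (S n)] for [F]. *)
  intros hF [|n] x; [exact I |]. simpl.
  apply ex_derive_ext with (Derive_n F (S n)); [| exact (hF (S (S n)) x)].
  intros t. change (Derive F) with (Derive_n F 1).
  rewrite Derive_n_comp. now rewrite Nat.add_1_r.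
Qed.

Lemma smooth_of_Derive (F : R -> R) :
  (forall x, ex_derive F x) -> smooth (Derive F) -> smooth F.
Proof.
  intros hF hD [|[|n]] x; [exact I | apply hF |]. simpl.
  apply ex_derive_ext with (Derive_n (Derive F) n); [| exact (hD (S n) x)].
  intros t. change (Derive F) with (Derive_n F 1).
  rewrite Derive_n_comp. now rewrite Nat.add_1_r.
Qed.

Lemma smooth_ext (F H : R -> R) : (forall x, F x = H x) -> smooth F -> smooth H.
Proof. intros e hF n x. now apply (ex_derive_n_ext F H). Qed.

Lemma smooth2_comp_linear (F : R -> R) (p q : R) :
  smooth F -> smooth2 (fun u v => F (p * u + q * v)).
Proof.
  intros hF.
  (* The free factor [c] closes the family under partial differentiation: it absorbs the [p] or [q]
     that the chain rule produces. *)
  assert (K : forall n F c, smooth F -> forall u v,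
    ex_diff_n (fun u v => c * F (p * u + q * v)) n u v).
  { clear. induction n as [|n IH]; intros F c hF u v;
    (assert (hc : continuity_2d_pt (fun u v => c * F (p * u + q * v)) u v);
     [apply continuity_2d_pt_mult; [apply continuity_2d_pt_const |];
      apply (continuity_1d_2d_pt_comp F (fun u v => p * u + q * v));
      [apply derivable_continuous_pt, ex_derive_Reals_0, smooth_ex_derive, hF |];
      apply continuity_2d_pt_plus; (apply continuity_2d_pt_mult;
        [apply continuity_2d_pt_const |]);
      [apply continuity_2d_pt_id1 | apply continuity_2d_pt_id2] |]).
    - split; [exact hc | exact I].
    - assert (E := fun x => smooth_ex_derive F x hF).
      repeat split; [exact hc | auto_derive; auto | auto_derive; auto | |].
      + apply ex_diff_n_ext_loc with (fun u v => (c * p) * Derive F (p * u + q * v)).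
        * apply locally_2d_forall. intros s t. symmetry.
          apply is_derive_unique. auto_derive; auto. change (fun x => F x) with F. ring.
        * apply IH, smooth_Derive, hF.
      + apply ex_diff_n_ext_loc with (fun u v => (c * q) * Derive F (p * u + q * v)).
        * apply locally_2d_forall. intros s t. symmetry.
          apply is_derive_unique. auto_derive; auto. change (fun x => F x) with F. ring.
        * apply IH, smooth_Derive, hF. }
  intros u v _ n. apply ex_diff_n_ext_loc with (fun u v => 1 * F (p * u + q * v)).
  - apply locally_2d_forall. intros; ring.
  - apply K, hF.
Qed.

Lemma smooth2_proj1 : smooth2 (fun u _ => u).
Proof.
  apply (smooth2_ext (fun u v => (1 * u + 0 * v) ^ 1)).
  - intros; ring.
  - apply (smooth2_comp_linear (fun x => x ^ 1)). intros n x. apply ex_derive_n_pow.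
Qed.

(** A first partial derivative that exists nearby and is continuous at the point, together with the
    second partial derivative at the point, gives total differentiability; this opens the way to the
    chain rule. *)
Lemma smooth2_on_differentiable (V : R * R -> Prop) (f : R -> R -> R) (u v : R) :
  open V -> smooth2_on V f -> V (u, v) ->
  differentiable_pt_lim f u v (D1 f u v) (D2 f u v).
Proof.
  intros hV hf huv. apply filterdiff_differentiable_pt_lim.
  apply (is_derive_filterdiff f u v (D1 f)).
  - apply (locally_open V _ hV); [| exact huv].
    intros [s t] h. apply Derive_correct. exact (proj1 (proj2 (hf s t h 1%nat))).
  - apply Derive_correct. exact (proj1 (proj2 (proj2 (hf u v huv 1%nat)))).
  - apply continuity_2d_pt_filterlim.
    exact (proj1 (smooth2_on_D1 V f hf u v huv 0%nat)).
Qed.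

Lemma is_derive_comp_2d (V : R * R -> Prop) (f : R -> R -> R) (a b : R -> R)
    (t da db : R) :
  open V -> smooth2_on V f -> V (a t, b t) -> is_derive a t da -> is_derive b t db ->
  is_derive (fun s => f (a s) (b s)) t (D1 f (a t) (b t) * da + D2 f (a t) (b t) * db).
Proof.
  intros hV hf h ha hb. apply is_derive_Reals, derivable_pt_lim_comp_2d.
  - now apply (smooth2_on_differentiable V).
  - now apply is_derive_Reals.
  - now apply is_derive_Reals.
Qed.

Lemma locally_line (V : R * R -> Prop) (u v c d t : R) :
  open V -> V (u + c * t, v + d * t) ->
  locally (T := R_UniformSpace) t (fun s => V (u + c * s, v + d * s)).
Proof.
  intros hV h.
  assert (ho : open (fun s : R_UniformSpace => V (u + c * s, v + d * s))).
  { apply (open_comp (U := prod_UniformSpace R_UniformSpace R_UniformSpace)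
      (fun s : R => (u + c * s, v + d * s)) V); [| exact hV].
    intros s _. apply filterlim_locally. intros eps. apply filter_and; simpl.
    - apply (proj1 (filterlim_locally (fun s => u + c * s) (u + c * s))).
      apply (ex_derive_continuous (fun s => u + c * s)). auto_derive; auto.
    - apply (proj1 (filterlim_locally (fun s => v + d * s) (v + d * s))).
      apply (ex_derive_continuous (fun s => v + d * s)). auto_derive; auto. }
  exact (ho t h).
Qed.

Lemma ex_derive_n_line (V : R * R -> Prop) (f : R -> R -> R) (u v c d : R) :
  open V -> smooth2_on V f ->
  forall t, V (u + c * t, v + d * t) ->
  forall n, ex_derive_n (fun s => f (u + c * s) (v + d * s)) n t.
Proof.
  intros hV hf.
  assert (L : forall h, smooth2_on V h -> forall t, V (u + c * t, v + d * t) ->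
    is_derive (fun s => h (u + c * s) (v + d * s)) t
     (c * D1 h (u + c * t) (v + d * t) + d * D2 h (u + c * t) (v + d * t))).
  { intros h hh t ht. rewrite (Rmult_comm c (D1 _ _ _)), (Rmult_comm d (D2 _ _ _)).
    apply (is_derive_comp_2d V h (fun s => u + c * s) (fun s => v + d * s)); auto;
    auto_derive; auto; ring. }
  (* Each derivative along the line is again the restriction of a smooth function on [V], obtained
     by iterating the directional derivative [c * D1 + d * D2]. *)
  assert (K : forall n, exists h, smooth2_on V h /\
    forall t, V (u + c * t, v + d * t) ->
      Derive_n (fun s => f (u + c * s) (v + d * s)) n t = h (u + c * t) (v + d * t)).
  { induction n as [|n (h & hh & e)].
    - exists f. split; auto.
    - exists (fun s t => c * D1 h s t + d * D2 h s t). split.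
      + apply smooth2_on_lincomb; auto; [now apply smooth2_on_D1 | now apply smooth2_on_D2].
      + intros t ht. simpl. erewrite Derive_ext_loc.
        * apply is_derive_unique, (L h hh t ht).
        * apply filter_imp with (2 := locally_line V u v c d t hV ht). exact e. }
  intros t ht [|n]; [exact I |]. destruct (K n) as (h & hh & e).
  eexists. eapply is_derive_ext_loc; [| apply (L h hh t ht)].
  apply filter_imp with (2 := locally_line V u v c d t hV ht).
  intros s hs. symmetry. now apply e.
Qed.

(** * Linear algebra of [g], [omega12] and [dz1_dz2] on pairs of vectors *)

Lemma C12_ext (v w : C12) :
  x1 v = x1 w -> x2 v = x2 w -> y1 v = y1 w -> y2 v = y2 w -> v = w.
Proof.
  destruct v as [[] []], w as [[] []]. unfold x1, x2, y1, y2, Re, Im; simpl.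
  now intros -> -> -> ->.
Qed.

Lemma x1_lincomb a v b w : x1 (lincomb a v b w) = a * x1 v + b * x1 w.
Proof. unfold x1, lincomb, Re; simpl. ring. Qed.
Lemma x2_lincomb a v b w : x2 (lincomb a v b w) = a * x2 v + b * x2 w.
Proof. unfold x2, lincomb, Re; simpl. ring. Qed.
Lemma y1_lincomb a v b w : y1 (lincomb a v b w) = a * y1 v + b * y1 w.
Proof. unfold y1, lincomb, Im; simpl. ring. Qed.
Lemma y2_lincomb a v b w : y2 (lincomb a v b w) = a * y2 v + b * y2 w.
Proof. unfold y2, lincomb, Im; simpl. ring. Qed.

Ltac coords := rewrite ?x1_lincomb, ?x2_lincomb, ?y1_lincomb, ?y2_lincomb.

Lemma g_lincomb a v b w c v' d w' :
  g (lincomb a v b w) (lincomb c v' d w') =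
    a * c * g v v' + a * d * g v w' + b * c * g w v' + b * d * g w w'.
Proof. unfold g. coords. ring. Qed.

Lemma g_sym v w : g v w = g w v.
Proof. unfold g. ring. Qed.

Lemma omega12_lincomb a v b w c d :
  omega12 (lincomb a v b w) (lincomb c v d w) = (a * d - b * c) * omega12 v w.
Proof. unfold omega12. coords. ring. Qed.

Lemma dz1_dz2_lincomb a v b w c d :
  dz1_dz2 (lincomb a v b w) (lincomb c v d w) =
    ((a * d - b * c)%R * dz1_dz2 v w)%C.
Proof.
  unfold dz1_dz2, lincomb. destruct v as [[] []], w as [[] []]; simpl.
  apply injective_projections; simpl; ring.
Qed.

Lemma lincomb_lincomb a b c d p q v w :
  lincomb p (lincomb a v b w) q (lincomb c v d w) =
  lincomb (p * a + q * c) v (p * b + q * d) w.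
Proof. apply C12_ext; coords; ring. Qed.

Lemma lincomb_0 v w : lincomb 0 v 0 w = zero12.
Proof. apply C12_ext; coords; unfold zero12, x1, x2, y1, y2, Re, Im; simpl; ring. Qed.

(* The Gram determinant of the Hermitian form [g + i omega12]. *)
Lemma gram_det v w :
  g v v * g w w - (g v w) ^ 2 - (omega12 v w) ^ 2 =
  - ((Re (dz1_dz2 v w)) ^ 2 + (Im (dz1_dz2 v w)) ^ 2).
Proof.
  unfold g, omega12, dz1_dz2, x1, x2, y1, y2, Re, Im.
  destruct v as [[] []], w as [[] []]; simpl. ring.
Qed.

(** By [gram_det], the Gram determinant of an isotropic pair for [omega12] is minus the squared
    modulus of [dz1_dz2]. Its negativity means signature (1, 1) on the span. *)
Lemma gram_negative v w :
  omega12 v w = 0 -> dz1_dz2 v w <> RtoC 0 -> g v v * g w w - (g v w) ^ 2 < 0.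
Proof.
  intros ho hz. pose proof (gram_det v w) as e. rewrite ho in e.
  apply Rnot_le_lt. intros k. apply hz.
  destruct (dz1_dz2 v w) as [p q]. unfold Re, Im in e; simpl fst in e; simpl snd in e.
  apply injective_projections; simpl fst; simpl snd; nra.
Qed.

(** Cramer's rule for the Gram matrix. *)
Lemma nondegenerate_gram v w (a b : R) :
  g v v * g w w - (g v w) ^ 2 <> 0 ->
  g (lincomb a v b w) v = 0 -> g (lincomb a v b w) w = 0 -> a = 0 /\ b = 0.
Proof.
  intros hd h1 h2.
  assert (E : forall z, g (lincomb a v b w) z = a * g v z + b * g w z)
    by (intros z; unfold g; coords; ring).
  rewrite E in h1, h2. rewrite (g_sym w v) in h1.
  split; apply Rmult_eq_reg_r with (2 := hd).
  - transitivity ((a * g v v + b * g v w) * g w w - (a * g v w + b * g w w) * g v w);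
    [ring | rewrite h1, h2; ring].
  - transitivity ((a * g v w + b * g w w) * g v v - (a * g v v + b * g v w) * g v w);
    [ring | rewrite h1, h2; ring].
Qed.

Lemma quadratic_form_negative (p q r : R) :
  p * r - q ^ 2 < 0 -> exists c d, p * c ^ 2 + 2 * q * c * d + r * d ^ 2 < 0.
Proof.
  intros h. destruct (total_order_T p 0) as [[hp | hp] | hp].
  - exists 1, 0. lra.
  - subst p. assert (hq : q <> 0) by (intros ->; lra).
    (* With [p = 0] and [d = 1] the form is affine in [c]; this [c] gives the value -1. *)
    exists ((- 1 - r) / (2 * q)), 1.
    replace (_ + _) with (-1) by (field; auto). lra.
  (* This vector is orthogonal to the first basis vector, and its value is [p] times the
     determinant. *)
  - exists (- q), p.
    replace (_ + _) with (p * (p * r - q ^ 2)) by ring. nra.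
Qed.

(** Gram-Schmidt in signature (1, 1): normalise a negative vector and complete it by a unit vector
    orthogonal to it, keeping the orientation. *)
Lemma adapted_basis (v w : C12) :
  g v v * g w w - (g v w) ^ 2 < 0 ->
  exists e1 e2, same_orientation v w e1 e2 /\
    g e1 e1 = -1 /\ g e2 e2 = 1 /\ g e1 e2 = 0.
Proof.
  intros h. destruct (quadratic_form_negative _ _ _ h) as (c & d & hn).
  set (n := - (g v v * c ^ 2 + 2 * g v w * c * d + g w w * d ^ 2)).
  set (D := - (g v v * g w w - g v w ^ 2)).
  assert (hn' : 0 < n) by (unfold n; lra). assert (hD : 0 < D) by (unfold D; lra).
  set (s := sqrt n). set (t := sqrt D).
  assert (hs : 0 < s) by now apply sqrt_lt_R0. assert (ht : 0 < t) by now apply sqrt_lt_R0.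
  assert (es : s * s = n) by (apply sqrt_sqrt; lra).
  assert (et : t * t = D) by (apply sqrt_sqrt; lra).
  (* Put [x = c v + d w], so that [g x x = - n]. The vector [- g x w * v + g x v * w] is orthogonal
     to [x] and has square [D * n], whence the divisor [s * t]. The minus signs in the first vector
     make the change of basis positive. *)
  exists (lincomb (- c / s) v (- d / s) w),
    (lincomb (- (g v w * c + g w w * d) / (s * t)) v ((g v v * c + g v w * d) / (s * t)) w).
  split.
  - do 4 eexists. split; [reflexivity | split; [reflexivity |]].
    replace (_ - _) with (n / (s * s * t)) by (unfold n; field; lra).
    apply Rdiv_lt_0_compat; [exact hn' | now repeat apply Rmult_lt_0_compat].
  - rewrite !g_lincomb, (g_sym w v). repeat split.
    + transitivity (- n / (s * s)); [unfold n; field; lra | rewrite es; field; lra].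
    + transitivity (D * n / ((s * s) * (t * t)));
      [unfold n, D; field; lra | rewrite es, et; field; lra].
    + field; lra.
Qed.

(** * Tangent planes and charts of graphs *)

Definition graph_pt (f1 f2 : R -> R -> R) (a b : R) : C12 := ((a, f1 a b), (b, f2 a b)).

Definition graph_d1 (f1 f2 : R -> R -> R) (a b : R) : C12 := ((1, D1 f1 a b), (0, D1 f2 a b)).

Definition graph_d2 (f1 f2 : R -> R -> R) (a b : R) : C12 := ((0, D2 f1 a b), (1, D2 f2 a b)).

Lemma velocity_graph (V : R * R -> Prop) (f1 f2 : R -> R -> R) (a b : R -> R) (t da db : R) :
  open V -> smooth2_on V f1 -> smooth2_on V f2 -> V (a t, b t) ->
  is_derive a t da -> is_derive b t db ->
  velocity (fun s => graph_pt f1 f2 (a s) (b s)) t =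
  lincomb da (graph_d1 f1 f2 (a t) (b t)) db (graph_d2 f1 f2 (a t) (b t)).
Proof.
  intros hV h1 h2 h ha hb. apply C12_ext; coords;
  unfold velocity, graph_pt, graph_d1, graph_d2, x1, x2, y1, y2, Re, Im; simpl.
  - etransitivity; [apply (is_derive_unique a t da ha) | ring].
  - etransitivity; [apply (is_derive_unique b t db hb) | ring].
  - etransitivity; [apply is_derive_unique, (is_derive_comp_2d V f1 a b t da db); assumption | ring].
  - etransitivity; [apply is_derive_unique, (is_derive_comp_2d V f2 a b t da db); assumption | ring].
Qed.

Lemma velocity_ext_loc (gam del : R -> C12) (t : R) :
  locally (T := R_UniformSpace) t (fun s => gam s = del s) ->
  velocity gam t = velocity del t.
Proof.
  intros h.
  assert (E : forall p : C12 -> R, Derive (fun s => p (gam s)) t = Derive (fun s => p (del s)) t).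
  { intros p. apply Derive_ext_loc. apply filter_imp with (2 := h).
    intros s e. now rewrite e. }
  unfold velocity. now rewrite (E x1), (E x2), (E y1), (E y2).
Qed.

Lemma graph_inv (f1 f2 : R -> R -> R) (z : C12) :
  graph f1 f2 z -> z = graph_pt f1 f2 (x1 z) (x2 z).
Proof. intros (a & b & ->). reflexivity. Qed.

(** A curve in the graph is the lift of its projection to the [(x1, x2)] plane, so the chain rule
    gives its velocity; conversely, lifts of straight lines realise every combination. *)
Lemma tangent_graph (f1 f2 : R -> R -> R) (a b : R) (v : C12) :
  smooth2 f1 -> smooth2 f2 ->
  tangent (graph f1 f2) (graph_pt f1 f2 a b) v <->
  exists c d, v = lincomb c (graph_d1 f1 f2 a b) d (graph_d2 f1 f2 a b).
Proof.
  intros h1 h2. split.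
  - intros (gam & e0 & ev & hl).
    exists (Derive (fun s => x1 (gam s)) 0), (Derive (fun s => x2 (gam s)) 0).
    rewrite <- ev.
    rewrite (velocity_ext_loc gam (fun s => graph_pt f1 f2 (x1 (gam s)) (x2 (gam s)))).
    2:{ apply filter_imp with (2 := hl). intros s [hs _]. now apply graph_inv. }
    destruct (locally_singleton _ _ hl) as [_ hd].
    destruct (hd 1%nat) as (d1 & d2 & _).
    rewrite (velocity_graph _ f1 f2 (fun s => x1 (gam s)) (fun s => x2 (gam s)) 0 _ _
      open_true h1 h2 I (Derive_correct _ _ d1) (Derive_correct _ _ d2)).
    now rewrite e0.
  - intros (c & d & ->).
    exists (fun t => graph_pt f1 f2 (a + c * t) (b + d * t)). split; [| split].
    + now rewrite !Rmult_0_r, !Rplus_0_r.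
    + rewrite (velocity_graph (fun _ => True) f1 f2 (fun t => a + c * t) (fun t => b + d * t) 0 c d);
      auto using open_true.
      * now rewrite !Rmult_0_r, !Rplus_0_r.
      * auto_derive; auto; ring.
      * auto_derive; auto; ring.
    + apply filter_forall. intros t. split; [now exists (a + c * t), (b + d * t) |].
      intros n. repeat split.
      * apply (ex_derive_n_line _ (fun u _ => u) a b c d open_true smooth2_proj1 t I).
      * apply (ex_derive_n_line _ (fun _ v => v) a b c d open_true (smooth2_swap _ smooth2_proj1) t I).
      * apply (ex_derive_n_line _ f1 a b c d open_true h1 t I).
      * apply (ex_derive_n_line _ f2 a b c d open_true h2 t I).
Qed.

(** The inclusion of the image in [M] is contained in [chart_openmap], applied to all of [V]. *)
Lemma chart_mem (M : C12 -> Prop) (V : R * R -> Prop) (phi : R -> R -> C12) (u v : R) :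
  chart M V phi -> V (u, v) -> M (phi u v).
Proof.
  intros hc h. destruct (chart_openmap _ _ _ hc V (chart_open _ _ _ hc) (fun _ k => k))
    as (U & _ & hU).
  apply hU. now exists u, v.
Qed.

Lemma tangent_chart_line (M : C12 -> Prop) (V : R * R -> Prop) (phi : R -> R -> C12)
    (u v c d : R) :
  chart M V phi -> V (u, v) ->
  tangent M (phi u v) (velocity (fun t => phi (u + c * t) (v + d * t)) 0).
Proof.
  intros hc h. exists (fun t => phi (u + c * t) (v + d * t)).
  split; [now rewrite !Rmult_0_r, !Rplus_0_r | split; [reflexivity |]].
  assert (hV := chart_open _ _ _ hc).
  eapply filter_imp; [| apply (locally_line V u v c d 0 hV)].
  - intros t ht. split; [now apply (chart_mem M V) |]. intros n.
    pose proof (fun f hf => ex_derive_n_line V f u v c d hV hf t ht n) as K.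
    repeat split.
    + exact (K _ (chart_smooth_x1 _ _ _ hc)).
    + exact (K _ (chart_smooth_x2 _ _ _ hc)).
    + exact (K _ (chart_smooth_y1 _ _ _ hc)).
    + exact (K _ (chart_smooth_y2 _ _ _ hc)).
  - now rewrite !Rmult_0_r, !Rplus_0_r.
Qed.

(** Tangent vectors are velocities at time 0, whereas [d_u] and [d_v] are taken at a coordinate
    value. The factor [1 *] matches the form of the curves in [tangent_chart_line]. *)
Lemma velocity_shift (gam : R -> C12) (u : R) :
  velocity (fun t => gam (u + 1 * t)) 0 = velocity gam u.
Proof.
  assert (E : forall p : C12 -> R,
    Derive (fun t => p (gam (u + 1 * t))) 0 = Derive (fun s => p (gam s)) u).
  { intros p. transitivity (Derive (fun s => p (gam s)) (0 + u)); [| now rewrite Rplus_0_l].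
    rewrite (Derive_ext _ (fun t => p (gam (t + u)))) by (intros; do 2 f_equal; ring).
    exact (Derive_n_comp_trans (fun s => p (gam s)) 1 0 u). }
  unfold velocity. now rewrite (E x1), (E x2), (E y1), (E y2).
Qed.

Lemma tangent_d_u (M : C12 -> Prop) (V : R * R -> Prop) (phi : R -> R -> C12) (u v : R) :
  chart M V phi -> V (u, v) -> tangent M (phi u v) (d_u phi u v).
Proof.
  intros hc h. unfold d_u. rewrite <- velocity_shift.
  pose proof (tangent_chart_line M V phi u v 1 0 hc h) as K.
  erewrite velocity_ext_loc; [exact K |].
  apply filter_forall. intros t. f_equal. ring.
Qed.

Lemma tangent_d_v (M : C12 -> Prop) (V : R * R -> Prop) (phi : R -> R -> C12) (u v : R) :
  chart M V phi -> V (u, v) -> tangent M (phi u v) (d_v phi u v).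
Proof.
  intros hc h. unfold d_v. rewrite <- velocity_shift.
  pose proof (tangent_chart_line M V phi u v 0 1 hc h) as K.
  erewrite velocity_ext_loc; [exact K |].
  apply filter_forall. intros t. f_equal. ring.
Qed.

Lemma d_u_graph (f1 f2 : R -> R -> R) (a b : R) :
  d_u (graph_pt f1 f2) a b = graph_d1 f1 f2 a b.
Proof.
  unfold d_u, velocity, graph_d1, graph_pt, x1, x2, y1, y2, Re, Im; simpl.
  now rewrite Derive_id, Derive_const.
Qed.

Lemma d_v_graph (f1 f2 : R -> R -> R) (a b : R) :
  d_v (graph_pt f1 f2) a b = graph_d2 f1 f2 a b.
Proof.
  unfold d_v, velocity, graph_d2, graph_pt, x1, x2, y1, y2, Re, Im; simpl.
  now rewrite Derive_id, Derive_const.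
Qed.

Lemma lin_indep_graph (f1 f2 : R -> R -> R) (a b : R) :
  lin_indep (graph_d1 f1 f2 a b) (graph_d2 f1 f2 a b).
Proof.
  intros c d e. pose proof (f_equal x1 e) as e1. pose proof (f_equal x2 e) as e2.
  rewrite x1_lincomb in e1. rewrite x2_lincomb in e2.
  unfold graph_d1, graph_d2, zero12, x1, x2, Re in e1, e2; simpl in e1, e2. lra.
Qed.

Lemma open_coords (W : R * R -> Prop) :
  open W -> open (fun z : C * C => W (x1 z, x2 z)).
Proof.
  intros hW. apply (open_comp (U := prod_UniformSpace R_UniformSpace R_UniformSpace)
    (fun z : C * C => (x1 z, x2 z)) W); [| exact hW].
  intros z _. apply filterlim_locally. intros eps. exists eps.
  intros z' [[h1 _] [h2 _]]. now split.
Qed.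

Lemma open_swap (W : R * R -> Prop) : open W -> open (fun q : R * R => W (snd q, fst q)).
Proof.
  intros hW. apply (open_comp (U := prod_UniformSpace R_UniformSpace R_UniformSpace)
    (T := prod_UniformSpace R_UniformSpace R_UniformSpace)
    (fun q : R * R => (snd q, fst q)) W); [| exact hW].
  intros z _. apply filterlim_locally. intros eps. exists eps.
  intros z' [h1 h2]. now split.
Qed.

Lemma chart_graph (f1 f2 : R -> R -> R) :
  smooth2 f1 -> smooth2 f2 -> chart (graph f1 f2) (fun _ => True) (graph_pt f1 f2).
Proof.
  intros h1 h2. split; auto using open_true.
  - exact smooth2_proj1.
  - exact (smooth2_swap _ smooth2_proj1).
  - intros u v _. rewrite d_u_graph, d_v_graph. apply lin_indep_graph.
  - intros u v u' v' _ _ e. split; [exact (f_equal x1 e) | exact (f_equal x2 e)].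
  (* The cylinder over [W] works, because the projection [(x1, x2)] inverts [graph_pt] on the
     graph. *)
  - intros W hW _. exists (fun z => W (x1 z, x2 z)). split; [now apply open_coords |].
    intros z. split.
    + intros [hz hw]. exists (x1 z), (x2 z). split; [exact hw | symmetry; now apply graph_inv].
    + intros (u & v & h & <-). split; [now exists u, v | exact h].
Qed.

(** Exchanging the parameters reverses the orientation of a global chart; this serves the case where
    [dz1_dz2] is negative on the coordinate basis. *)
Lemma chart_swap (M : C12 -> Prop) (phi : R -> R -> C12) :
  chart M (fun _ => True) phi -> chart M (fun _ => True) (fun u v => phi v u).
Proof.
  intros [_ s1 s2 s3 s4 himm hinj hmap]. split; auto using open_true.
  - exact (smooth2_swap _ s1).
  - exact (smooth2_swap _ s2).
  - exact (smooth2_swap _ s3).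
  - exact (smooth2_swap _ s4).
  - intros u v _ a b e. apply and_comm. apply (himm v u I). rewrite <- e.
    apply C12_ext; coords; apply Rplus_comm.
  - intros u v u' v' _ _ e. apply and_comm. now apply hinj.
  - intros W hW _. destruct (hmap _ (open_swap W hW) (fun _ _ => I)) as (U & hU & e).
    exists U. split; [exact hU |]. intros z. rewrite e.
    split; intros (u & v & h & k); now exists v, u.
Qed.

(** * Lagrangian and special Lagrangian graphs in terms of coordinate bases *)

(** The form [omega12] vanishes on a plane as soon as it vanishes on one basis. The Gram determinant
    is then minus the squared modulus of [dz1_dz2], so non-degeneracy amounts to [dz1_dz2] being
    nonzero. *)
Lemma lagrangian_graph (f1 f2 : R -> R -> R) :
  smooth2 f1 -> smooth2 f2 ->
  lagrangian (graph f1 f2) <->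
  forall a b, omega12 (graph_d1 f1 f2 a b) (graph_d2 f1 f2 a b) = 0 /\
    dz1_dz2 (graph_d1 f1 f2 a b) (graph_d2 f1 f2 a b) <> RtoC 0.
Proof.
  intros h1 h2. pose proof (fun a b v => tangent_graph f1 f2 a b v h1 h2) as T. split.
  - intros (_ & hom & hnd) a b.
    assert (hp : graph f1 f2 (graph_pt f1 f2 a b)) by now exists a, b.
    set (v := graph_d1 f1 f2 a b). set (w := graph_d2 f1 f2 a b).
    assert (L : forall c d, tangent (graph f1 f2) (graph_pt f1 f2 a b) (lincomb c v d w))
      by (intros c d; apply T; now exists c, d).
    assert (ho : omega12 v w = 0).
    { pose proof (hom _ _ _ hp (L 1 0) (L 0 1)) as e. rewrite omega12_lincomb in e. lra. }
    split; [exact ho |]. intros hz.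
    assert (hd : g v v * g w w = g v w * g v w).
    { pose proof (gram_det v w) as e. rewrite ho, hz in e.
      change (Re (RtoC 0)) with 0 in e. change (Im (RtoC 0)) with 0 in e. lra. }
    (* Non-degeneracy, tested on the basis [v], [w] only. *)
    assert (K : forall c d, g (lincomb c v d w) v = 0 -> g (lincomb c v d w) w = 0 ->
      c = 0 /\ d = 0).
    { intros c d e1 e2. apply (lin_indep_graph f1 f2 a b). apply (hnd _ _ hp (L c d)).
      intros z hz'. apply T in hz' as (c' & d' & ->). fold v w.
      transitivity (c' * g (lincomb c v d w) v + d' * g (lincomb c v d w) w);
      [unfold g; coords; ring | rewrite e1, e2; ring]. }
    assert (E : forall c d z, g (lincomb c v d w) z = c * g v z + d * g w z)
      by (intros c d z; unfold g; coords; ring).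
    (* Both rows of the singular Gram matrix yield kernel vectors. *)
    destruct (K (g v w) (- g v v)) as [k1 k2];
      [rewrite E, (g_sym w v); ring | rewrite E; lra |].
    (* The first row is now zero, so [v] itself is orthogonal to the tangent plane, which is
       absurd. *)
    destruct (K 1 0) as [k _]; [rewrite E; lra | rewrite E, k1; ring | lra].
  - intros H. split; [| split].
    + intros p (a & b & ->). exists (fun _ => True), (graph_pt f1 f2).
      split; [now apply chart_graph | now exists a, b].
    + intros p v w (a & b & ->) hv hw. apply T in hv as (c & d & ->), hw as (c' & d' & ->).
      rewrite omega12_lincomb, (proj1 (H a b)). ring.
    + intros p v (a & b & ->) hv hg. apply T in hv as (c & d & ->).
      destruct (H a b) as [ho hz].
      set (v := graph_d1 f1 f2 a b) in *. set (w := graph_d2 f1 f2 a b) in *.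
      destruct (nondegenerate_gram v w c d) as [-> ->].
      * now apply Rlt_not_eq, gram_negative.
      * apply hg, T. exists 1, 0. apply C12_ext; coords; fold v w; ring.
      * apply hg, T. exists 0, 1. apply C12_ext; coords; fold v w; ring.
      * apply lincomb_0.
Qed.

(** By [gram_det] the value on [e1], [e2] has modulus 1, and it is a positive multiple of a positive
    real number. *)
Lemma dz1_dz2_orthonormal (v w e1 e2 : C12) :
  omega12 v w = 0 -> Im (dz1_dz2 v w) = 0 -> 0 < Re (dz1_dz2 v w) ->
  same_orientation v w e1 e2 ->
  g e1 e1 = -1 -> g e2 e2 = 1 -> g e1 e2 = 0 -> dz1_dz2 e1 e2 = RtoC 1.
Proof.
  intros ho him hre (a & b & c & d & E1 & E2 & hdet) h1 h2 h3.
  pose proof (gram_det e1 e2) as hd. rewrite h1, h2, h3 in hd.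
  assert (ho' : omega12 e1 e2 = 0) by (subst; rewrite omega12_lincomb, ho; ring).
  assert (hz : dz1_dz2 e1 e2 = ((a * d - b * c)%R * dz1_dz2 v w)%C)
    by (subst; apply dz1_dz2_lincomb).
  destruct (dz1_dz2 v w) as [p q], (dz1_dz2 e1 e2) as [p' q'].
  apply (f_equal (fun z => (Re z, Im z))) in hz.
  unfold Re, Im in *; simpl in *. injection hz as hp hq. subst q.
  rewrite ho' in hd. assert (0 < p') by nra.
  apply injective_projections; simpl; nra.
Qed.

(** A global chart orients the surface: [O] at [phi u v] is the class of the coordinate basis there,
    unambiguous since [phi] is injective. *)
Lemma positive_chart_special_lagrangian (M : C12 -> Prop) (phi : R -> R -> C12) :
  lagrangian M -> chart M (fun _ => True) phi ->
  (forall p, M p -> exists u v, phi u v = p) ->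
  (forall u v, Im (dz1_dz2 (d_u phi u v) (d_v phi u v)) = 0 /\
     0 < Re (dz1_dz2 (d_u phi u v) (d_v phi u v))) ->
  exists O, timelike_special_lagrangian M O.
Proof.
  intros hL hc hsurj hz.
  exists (fun p e1 e2 => exists u v, phi u v = p /\
    same_orientation (d_u phi u v) (d_v phi u v) e1 e2).
  split; [exact hL | split].
  - intros p hp. exists (fun _ => True), phi. split; [exact hc | split].
    + destruct (hsurj p hp) as (u & v & e). now exists u, v.
    + intros u v _ e1 e2. split; [| now exists u, v].
      intros (u' & v' & e & h).
      now destruct (chart_inj _ _ _ hc u' v' u v I I e) as [-> ->].
  - intros p e1 e2 hp (u & v & e & h). destruct (hz u v) as [hi hr].
    revert h. apply dz1_dz2_orthonormal; auto.
    apply (proj1 (proj2 hL) p); auto; rewrite <- e;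
    [now apply (tangent_d_u M (fun _ => True)) | now apply (tangent_d_v M (fun _ => True))].
Qed.

(** The orientation is arbitrary and known only through some local chart. The coordinate basis of
    that chart is a real change of basis away from the one of the graph, and a positive adapted
    basis, where [dz1_dz2] is 1, is another one away. Hence [dz1_dz2] is real on the basis of the
    graph. *)
Lemma special_lagrangian_graph_im (f1 f2 : R -> R -> R) (O : C12 -> C12 -> C12 -> Prop) (a b : R) :
  smooth2 f1 -> smooth2 f2 -> timelike_special_lagrangian (graph f1 f2) O ->
  Im (dz1_dz2 (graph_d1 f1 f2 a b) (graph_d2 f1 f2 a b)) = 0.
Proof.
  intros h1 h2 (hL & hO & hS).
  assert (hp : graph f1 f2 (graph_pt f1 f2 a b)) by now exists a, b.
  destruct (proj1 (lagrangian_graph f1 f2 h1 h2) hL a b) as [hom hnz].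
  destruct (hO _ hp) as (V & phi & hc & (u & v & huv & e) & hor).
  pose proof (tangent_d_u _ V phi u v hc huv) as hu.
  pose proof (tangent_d_v _ V phi u v hc huv) as hv.
  pose proof (chart_immersion _ _ _ hc u v huv) as hind.
  specialize (hor u v huv). rewrite e in hu, hv, hor.
  apply (tangent_graph f1 f2 a b _ h1 h2) in hu as (c1 & c2 & eu).
  apply (tangent_graph f1 f2 a b _ h1 h2) in hv as (k1 & k2 & ev).
  rewrite eu, ev in hor, hind. clear eu ev.
  set (E1 := graph_d1 f1 f2 a b) in *. set (E2 := graph_d2 f1 f2 a b) in *.
  (* If the determinant vanished, the relations [(k2, - c2)] and [(k1, - c1)] would force all four
     coefficients to be 0, contradicting the immersion property. *)
  assert (hdet : c1 * k2 - c2 * k1 <> 0).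
  { intros hd.
    destruct (hind k2 (- c2)) as [z1 z2].
    { rewrite lincomb_lincomb, <- (lincomb_0 E1 E2). f_equal; lra. }
    destruct (hind k1 (- c1)) as [z3 z4].
    { rewrite lincomb_lincomb, <- (lincomb_0 E1 E2). f_equal; lra. }
    destruct (hind 1 0) as [z5 _]; [| lra].
    rewrite lincomb_lincomb, <- (lincomb_0 E1 E2). f_equal; lra. }
  set (v1 := lincomb c1 E1 c2 E2) in *. set (v2 := lincomb k1 E1 k2 E2) in *.
  assert (hom' : omega12 v1 v2 = 0) by (unfold v1, v2; rewrite omega12_lincomb, hom; ring).
  assert (hz : dz1_dz2 v1 v2 = ((c1 * k2 - c2 * k1)%R * dz1_dz2 E1 E2)%C)
    by apply dz1_dz2_lincomb.
  destruct (adapted_basis v1 v2) as (e1 & e2 & hso & g1 & g2 & g3).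
  { apply gram_negative; [exact hom' |]. rewrite hz. apply Cmult_neq_0; [| exact hnz].
    intros k. apply hdet. now injection k. }
  pose proof (hS _ e1 e2 hp (proj2 (hor e1 e2) hso) g1 g2 g3) as h.
  destruct hso as (p & q & r & s & -> & -> & hpos).
  rewrite dz1_dz2_lincomb, hz in h.
  destruct (dz1_dz2 E1 E2) as [m n].
  apply (f_equal Im) in h. unfold Im in *; simpl in *.
  apply Rmult_eq_reg_l with ((p * s - q * r) * (c1 * k2 - c2 * k1)).
  - rewrite Rmult_0_r, <- h. ring.
  - apply Rmult_integral_contrapositive_currified; [lra | exact hdet].
Qed.

(** * Graphs of gradients of solutions of the wave equation *)

(** With [gradient2], this is the gradient of [F (a + b) + G (a - b)] for the metric
    [- dx1^2 + dx2^2], hence the minus sign. *)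
Definition gradient1 (F G : R -> R) (a b : R) : R := - (Derive F (a + b) + Derive G (a - b)).

Definition gradient2 (F G : R -> R) (a b : R) : R := Derive F (a + b) - Derive G (a - b).

Lemma gradient_graph_sum (F G : R -> R) : smooth F -> smooth G ->
  gradient_graph (fun a b => F (a + b) + G (a - b)) =
  graph (gradient1 F G) (gradient2 F G).
Proof.
  intros hF hG. unfold gradient_graph, gradient1, gradient2.
  assert (EF := fun x => smooth_ex_derive F x hF).
  assert (EG := fun x => smooth_ex_derive G x hG).
  f_equal; apply functional_extensionality; intros a; apply functional_extensionality; intros b.
  - f_equal. apply is_derive_unique. auto_derive; auto.
    change (fun x => F x) with F. change (fun x => G x) with G. unfold Rminus. ring.
  - apply is_derive_unique. auto_derive; auto.
    change (fun x => F x) with F. change (fun x => G x) with G. unfold Rminus. ring.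
Qed.

Lemma smooth2_sum_diff (F G : R -> R) (p q : R) : smooth F -> smooth G ->
  smooth2 (fun a b => p * F (a + b) + q * G (a - b)).
Proof.
  intros hF hG.
  apply (smooth2_ext (fun a b => p * F (1 * a + 1 * b) + q * G (1 * a + (-1) * b))).
  - intros a b. f_equal; do 2 f_equal; ring.
  - apply smooth2_on_lincomb; [apply open_true | | ];
    now apply smooth2_comp_linear.
Qed.

Lemma smooth2_gradient (F G : R -> R) : smooth F -> smooth G ->
  smooth2 (gradient1 F G) /\ smooth2 (gradient2 F G).
Proof.
  intros hF hG.
  pose proof (smooth_Derive F hF) as kF. pose proof (smooth_Derive G hG) as kG. split.
  - apply (smooth2_ext (fun a b => (-1) * Derive F (a + b) + (-1) * Derive G (a - b)));
    [intros; unfold gradient1; ring | now apply smooth2_sum_diff].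
  - apply (smooth2_ext (fun a b => 1 * Derive F (a + b) + (-1) * Derive G (a - b)));
    [intros; unfold gradient2; ring | now apply smooth2_sum_diff].
Qed.

Lemma graph_d1_gradient (F G : R -> R) (a b : R) : smooth F -> smooth G ->
  graph_d1 (gradient1 F G) (gradient2 F G) a b =
  ((1, - (Derive_n F 2 (a + b) + Derive_n G 2 (a - b))),
   (0, Derive_n F 2 (a + b) - Derive_n G 2 (a - b))).
Proof.
  intros hF hG.
  assert (EF := fun x => smooth_ex_derive _ x (smooth_Derive F hF)).
  assert (EG := fun x => smooth_ex_derive _ x (smooth_Derive G hG)).
  unfold graph_d1, D1, gradient1, gradient2. do 2 f_equal; apply is_derive_unique.
  all: auto_derive; auto; simpl; unfold Rminus.
  all: change (fun x => F x) with F; change (fun x => G x) with G.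
  all: change (fun x => Derive F x) with (Derive F); change (fun x => Derive G x) with (Derive G).
  all: ring.
Qed.

Lemma graph_d2_gradient (F G : R -> R) (a b : R) : smooth F -> smooth G ->
  graph_d2 (gradient1 F G) (gradient2 F G) a b =
  ((0, - (Derive_n F 2 (a + b) - Derive_n G 2 (a - b))),
   (1, Derive_n F 2 (a + b) + Derive_n G 2 (a - b))).
Proof.
  intros hF hG.
  assert (EF := fun x => smooth_ex_derive _ x (smooth_Derive F hF)).
  assert (EG := fun x => smooth_ex_derive _ x (smooth_Derive G hG)).
  unfold graph_d2, D2, gradient1, gradient2. do 2 f_equal; apply is_derive_unique.
  all: auto_derive; auto; simpl; unfold Rminus.
  all: change (fun x => F x) with F; change (fun x => G x) with G.
  all: change (fun x => Derive F x) with (Derive F); change (fun x => Derive G x) with (Derive G).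
  all: ring.
Qed.

(** Writing [p], [q] for the second derivatives of [F], [G], the determinant is
    [1 + (p + q)^2 - (p - q)^2]. *)
Lemma dz1_dz2_gradient (F G : R -> R) (a b : R) : smooth F -> smooth G ->
  dz1_dz2 (graph_d1 (gradient1 F G) (gradient2 F G) a b) (graph_d2 (gradient1 F G) (gradient2 F G) a b) =
  RtoC (4 * Derive_n F 2 (a + b) * Derive_n G 2 (a - b) + 1).
Proof.
  intros hF hG.
  rewrite graph_d1_gradient, graph_d2_gradient by assumption. unfold dz1_dz2.
  apply injective_projections; simpl; ring.
Qed.

(** The form [omega12] vanishes by the symmetry of the mixed second derivatives, which leaves the
    condition on [dz1_dz2]. Both halves of the theorem use this equivalence, in opposite
    directions. *)
Lemma lagrangian_gradient (F G : R -> R) : smooth F -> smooth G ->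
  lagrangian (graph (gradient1 F G) (gradient2 F G)) <->
  forall a b, 4 * Derive_n F 2 (a + b) * Derive_n G 2 (a - b) + 1 <> 0.
Proof.
  intros hF hG.
  destruct (smooth2_gradient F G hF hG) as [h1 h2]. rewrite (lagrangian_graph (gradient1 F G) (gradient2 F G) h1 h2).
  split; intros H a b.
  - destruct (H a b) as [_ K]. rewrite dz1_dz2_gradient in K by assumption. intros e. apply K. now rewrite e.
  - rewrite dz1_dz2_gradient by assumption. split.
    + rewrite graph_d1_gradient, graph_d2_gradient by assumption.
      unfold omega12, x1, x2, y1, y2, Re, Im; simpl. ring.
    + intros e. apply (H a b). now injection e.
Qed.

Lemma nonvanishing_same_sign (h : R -> R) (x y : R) :
  continuity h -> (forall t, h t <> 0) -> 0 < h x * h y.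
Proof.
  intros hc hn. apply Rnot_le_lt. intros hle.
  destruct (IVT_gen h x y 0 hc) as (z & _ & hz); [| exact (hn z hz)].
  pose proof (hn x). pose proof (hn y).
  unfold Rmin, Rmax. destruct (Rle_dec (h x) (h y)); nra.
Qed.

Lemma gradient_special_lagrangian (F G : R -> R) :
  smooth F -> smooth G ->
  (forall a b : R, 4 * Derive_n F 2 (a + b) * Derive_n G 2 (a - b) + 1 <> 0) ->
  exists O, timelike_special_lagrangian
    (gradient_graph (fun a b => F (a + b) + G (a - b))) O.
Proof.
  intros hF hG hn. rewrite gradient_graph_sum by assumption.
  pose proof (fun a b => dz1_dz2_gradient F G a b hF hG) as hdz.
  pose proof (proj2 (lagrangian_gradient F G hF hG) hn) as hL.
  destruct (smooth2_gradient F G hF hG) as [s1 s2].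
  set (f1 := gradient1 F G) in *. set (f2 := gradient2 F G) in *.
  (* The sign of [dz1_dz2] at [(a, b)] is that at the origin, by the intermediate value theorem on
     the segment [(t * a, t * b)]. *)
  assert (hs : forall a b,
    0 < (4 * Derive_n F 2 0 * Derive_n G 2 0 + 1) *
        (4 * Derive_n F 2 (a + b) * Derive_n G 2 (a - b) + 1)).
  { intros a b.
    pose proof (nonvanishing_same_sign
      (fun t => 4 * Derive_n F 2 (t * a + t * b) * Derive_n G 2 (t * a - t * b) + 1) 0 1) as K.
    cbv beta in K. rewrite !Rmult_0_l, !Rmult_1_l, Rplus_0_l, Rminus_0_r in K.
    apply K; [| intros t; apply hn].
    intros t. apply continuity_pt_filterlim.
    apply (ex_derive_continuous
      (fun t => 4 * Derive_n F 2 (t * a + t * b) * Derive_n G 2 (t * a - t * b) + 1)).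
    pose proof (fun x => hF 3%nat x : ex_derive (Derive_n F 2) x).
    pose proof (fun x => hG 3%nat x : ex_derive (Derive_n G 2) x).
    revert H H0. generalize (Derive_n F 2) (Derive_n G 2). intros F2 G2 ? ?.
    auto_derive; auto. }
  pose proof (chart_graph f1 f2 s1 s2) as hc.
  (* The sign at the origin decides between the standard chart and the one with exchanged
     parameters. *)
  destruct (Rlt_or_le 0 (4 * Derive_n F 2 0 * Derive_n G 2 0 + 1)) as [h0 | h0].
  - apply (positive_chart_special_lagrangian _ (graph_pt f1 f2) hL hc).
    + intros p (a & b & ->). now exists a, b.
    + intros a b. rewrite d_u_graph, d_v_graph, hdz. split; [reflexivity |].
      change (0 < 4 * Derive_n F 2 (a + b) * Derive_n G 2 (a - b) + 1).
      specialize (hs a b). nra.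
  - apply (positive_chart_special_lagrangian _ (fun u v => graph_pt f1 f2 v u) hL).
    + now apply chart_swap.
    + intros p (a & b & ->). now exists b, a.
    + intros b a. change (d_u (fun u v => graph_pt f1 f2 v u) b a) with (d_v (graph_pt f1 f2) a b).
      change (d_v (fun u v => graph_pt f1 f2 v u) b a) with (d_u (graph_pt f1 f2) a b).
      rewrite d_u_graph, d_v_graph.
      replace (dz1_dz2 (graph_d2 f1 f2 a b) (graph_d1 f1 f2 a b)) with
        (- dz1_dz2 (graph_d1 f1 f2 a b) (graph_d2 f1 f2 a b))%C by (unfold dz1_dz2; ring).
      rewrite hdz. split; [apply Ropp_0 |].
      change (0 < - (4 * Derive_n F 2 (a + b) * Derive_n G 2 (a - b) + 1)).
      specialize (hs a b). nra.
Qed.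

(** * From a special Lagrangian graph back to [F] and [G] *)

(** A solution is constant along each characteristic [a + c * b = const]; the mean value theorem
    compares [(a, b)] with the point where its characteristic meets the axis [b = 0]. *)
Lemma transport_solution (h : R -> R -> R) (c : R) :
  smooth2 h -> (forall a b, D2 h a b = c * D1 h a b) ->
  forall a b, h a b = h (a + c * b) 0.
Proof.
  intros hh e a b.
  destruct (MVT_gen (fun t => h (a + c * b + - c * t) t) 0 b (fun _ => 0)) as (t & _ & k).
  - intros t _.
    replace 0 with (D1 h (a + c * b + - c * t) t * (- c) + D2 h (a + c * b + - c * t) t * 1)
      by (rewrite e; ring).
    apply (is_derive_comp_2d (fun _ => True) h (fun t => a + c * b + - c * t) (fun t => t));
    auto using open_true; auto_derive; auto; ring.
  - intros t _. apply continuity_pt_filterlim.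
    apply (ex_derive_continuous (fun t => h (a + c * b + - c * t) t)).
    eexists. apply (is_derive_comp_2d (fun _ => True) h (fun t => a + c * b + - c * t) (fun t => t));
    auto using open_true; auto_derive; auto; ring.
  - replace (a + c * b + - c * b) with a in k by ring.
    replace (a + c * b + - c * 0) with (a + c * b) in k by ring. lra.
Qed.

Lemma smooth_antiderivative (f : R -> R) :
  smooth f -> exists F, smooth F /\ forall x, Derive F x = f x.
Proof.
  intros hf.
  assert (hc : forall x, continuous f x)
    by (intros; apply (ex_derive_continuous f), smooth_ex_derive, hf).
  assert (hd : forall x, is_derive (RInt f 0) x (f x)).
  { intros x. apply (is_derive_RInt f (RInt f 0) 0); [| apply hc].
    apply filter_forall. intros y. apply (RInt_correct f).
    apply (ex_RInt_continuous f). intros; apply hc. }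
  exists (RInt f 0). split; [| intros; now apply is_derive_unique].
  apply smooth_of_Derive; [intros x; now exists (f x) |].
  apply (smooth_ext f); [| exact hf]. intros x. symmetry. now apply is_derive_unique.
Qed.

Lemma smooth_section (h : R -> R -> R) : smooth2 h -> smooth (fun s => h s 0).
Proof.
  intros hh n t.
  apply (ex_derive_n_ext (fun s => h (0 + 1 * s) (0 + 0 * s))).
  - intros s. f_equal; ring.
  - exact (ex_derive_n_line _ h 0 0 1 0 open_true hh t I n).
Qed.

Lemma special_lagrangian_graph_gradient (f1 f2 : R -> R -> R) (O : C12 -> C12 -> C12 -> Prop) :
  smooth2 f1 -> smooth2 f2 -> timelike_special_lagrangian (graph f1 f2) O ->
  exists F G, smooth F /\ smooth G /\
    graph f1 f2 = graph (gradient1 F G) (gradient2 F G).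
Proof.
  intros h1 h2 hS.
  (* The first equation is the vanishing of [omega12], the second that of the imaginary part of
     [dz1_dz2]. *)
  assert (P : forall a b, D2 f1 a b = - D1 f2 a b /\ D2 f2 a b = - D1 f1 a b).
  { intros a b.
    pose proof (proj1 (proj1 (lagrangian_graph f1 f2 h1 h2) (proj1 hS) a b)) as ho.
    pose proof (special_lagrangian_graph_im f1 f2 O a b h1 h2 hS) as hi.
    unfold omega12, dz1_dz2, graph_d1, graph_d2, x1, x2, y1, y2, Re, Im in ho, hi.
    simpl in ho, hi. lra. }
  assert (L : forall p q, smooth2 (fun a b => p * f1 a b + q * f2 a b) /\
    (forall a b, D1 (fun a b => p * f1 a b + q * f2 a b) a b = p * D1 f1 a b + q * D1 f2 a b) /\
    (forall a b, D2 (fun a b => p * f1 a b + q * f2 a b) a b = p * D2 f1 a b + q * D2 f2 a b)).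
  { intros p q. split; [now apply smooth2_on_lincomb; [apply open_true | |] |].
    split; intros a b;
    destruct (h1 a b I 1%nat) as (_ & d1 & d2 & _), (h2 a b I 1%nat) as (_ & k1 & k2 & _);
    unfold D1, D2; rewrite Derive_plus by (auto_derive; auto); now rewrite !Derive_scal. }
  (* Solving [f1 = - (F' + G')] and [f2 = F' - G'] gives [F' = (f2 - f1) / 2] and
     [G' = - (f1 + f2) / 2]. The antiderivatives are taken of their restrictions to [b = 0]. *)
  destruct (L (-1/2) (1/2)) as (sm & m1 & m2). destruct (L (-1/2) (-1/2)) as (sp & p1 & p2).
  destruct (smooth_antiderivative _ (smooth_section _ sm)) as (F & hF & eF).
  destruct (smooth_antiderivative _ (smooth_section _ sp)) as (G & hG & eG).
  exists F, G. split; [exact hF | split; [exact hG |]].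
  (* By [P] the candidate for [F'] satisfies the transport equation with [c = 1], and the one for
     [G'] that with [c = -1]. *)
  assert (A : forall a b, Derive F (a + b) = -1/2 * f1 a b + 1/2 * f2 a b).
  { intros a b. rewrite eF. replace (a + b) with (a + 1 * b) by ring.
    symmetry. apply (transport_solution _ 1 sm). intros s t. rewrite m1, m2.
    destruct (P s t) as [-> ->]. lra. }
  assert (B : forall a b, Derive G (a - b) = -1/2 * f1 a b + -1/2 * f2 a b).
  { intros a b. rewrite eG. replace (a - b) with (a + (-1) * b) by ring.
    symmetry. apply (transport_solution _ (-1) sp). intros s t. rewrite p1, p2.
    destruct (P s t) as [-> ->]. lra. }
  f_equal; apply functional_extensionality; intros a; apply functional_extensionality; intros b;
  unfold gradient1, gradient2; rewrite A, B; field.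
Qed.

Theorem proposition3p3 :
  (forall F G : R -> R, smooth F -> smooth G ->
     (forall a b : R, 4 * Derive_n F 2 (a + b) * Derive_n G 2 (a - b) + 1 <> 0) ->
     exists O : C12 -> C12 -> C12 -> Prop,
       timelike_special_lagrangian
         (gradient_graph (fun a b => F (a + b) + G (a - b))) O)
  /\
  (forall (M : C12 -> Prop) (O : C12 -> C12 -> C12 -> Prop),
     timelike_special_lagrangian M O ->
     (exists f1 f2 : R -> R -> R,
        smooth2 f1 /\ smooth2 f2 /\ forall z : C12, M z <-> graph f1 f2 z) ->
     exists F G : R -> R,
       smooth F /\ smooth G /\
       (forall a b : R, 4 * Derive_n F 2 (a + b) * Derive_n G 2 (a - b) + 1 <> 0) /\
       forall z : C12, M z <-> gradient_graph (fun a b => F (a + b) + G (a - b)) z).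
Proof.
  split; [exact gradient_special_lagrangian |].
  intros M O hS (f1 & f2 & h1 & h2 & e).
  (* Equality of predicates, rather than pointwise equivalence, carries tangent vectors and charts
     over at once. *)
  assert (E : M = graph f1 f2)
    by (apply functional_extensionality; intros z; apply propositional_extensionality, e).
  subst M. clear e.
  destruct (special_lagrangian_graph_gradient f1 f2 O h1 h2 hS) as (F & G & hF & hG & E).
  exists F, G. split; [exact hF | split; [exact hG | split]].
  (* The inequality comes from the Lagrangian condition alone, through the non-degeneracy of the
     metric. *)
  - apply (lagrangian_gradient F G hF hG). rewrite <- E. apply hS.
  - intros z. now rewrite gradient_graph_sum, E.
Qed.
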